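(* Let $N\ge1$, let $\Omega\subset\mathbb{R}^N$ be a bounded domain with Lipschitz boundary, let $p>1$, $s\in(0,1)$, $f\in L^{p'}(\Omega)$ and $g\in L^1(\mathbb{R}^N\setminus\Omega)$. Let $u\in X$ be a weak solution of $$\begin{cases}(-\Delta)^s_p u=f&\text{in }\Omega,\\ \mathscr{N}_{s,p}u=g&\text{in }\mathbb{R}^N\setminus\overline\Omega\end{cases}$$ with $f\ge0$ and $g\ge0$. Then $u$ is constant.
   Context: Write $C\Omega=\mathbb{R}^N\setminus\Omega$, $p'=p/(p-1)$ and $J_p(\tau)=|\tau|^{p-2}\tau$. Here $(-\Delta)^s_p u(x)=\mathrm{PV}\int_{\mathbb{R}^N}\frac{J_p(u(x)-u(y))}{|x-y|^{N+ps}}\,dy$ and $\mathscr{N}_{s,p}u(x)=\int_\Omega\frac{J_p(u(x)-u(y))}{|x-y|^{N+ps}}\,dy$ for $x\in\mathbb{R}^N\setminus\overline\Omega$ (normalizing constant set equal to $1$). The space $X$ (depending on $g$) consists of all measurable $u:\mathbb{R}^N\to\mathbb{R}$ with $$\|u\|_X^p=\|u\|_{L^p(\Omega)}^p+\big\||g|^{1/p}u\big\|_{L^p(\mathbb{R}^N\setminus\Omega)}^p+\int_{\mathbb{R}^{2N}\setminus(C\Omega)^2}\frac{|u(x)-u(y)|^p}{|x-y|^{N+ps}}\,dx\,dy<\infty ;$$ as usual, functions are identified when they agree a.e. (Since $\partial\Omega$ has measure zero, $\mathbb{R}^N\setminus\Omega$ and $\mathbb{R}^N\setminus\overline\Omega$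 are interchangeable in integrals.) A function $u\in X$ is a weak solution of the problem if for every $v\in X$ $$\frac12\int_{\mathbb{R}^{2N}\setminus(C\Omega)^2}\frac{J_p(u(x)-u(y))(v(x)-v(y))}{|x-y|^{N+ps}}\,dx\,dy=\int_\Omega fv\,dx+\int_{\mathbb{R}^N\setminus\overline\Omega}gv\,dx .$$ *)

(* Defs.v *)
From HB Require Import structures.
From mathcomp Require Import all_boot all_order all_algebra.
From mathcomp Require Import all_classical all_reals all_analysis.

Set Implicit Arguments.
Unset Strict Implicit.
Unset Printing Implicit Defensive.
Import Order.TTheory GRing.Theory Num.Theory.
Import numFieldNormedType.Exports.
Local Open Scope classical_set_scope.
Local Open Scope ring_scope.

(* As in the library's instance for tuples, 'rV[R]_n carries the sigma-algebra
   generated by the coordinates, which is the Borel sigma-algebra of R^n. *)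
Section measurable_rV.
Context (R : realType) (n : nat).

Let coors (i : 'I_n) (x : 'rV[R]_n) : R := x ord0 i.

Let rV_set0 : g_sigma_preimage coors set0.
Proof. exact: sigma_algebra0. Qed.

Let rV_setC A : g_sigma_preimage coors A -> g_sigma_preimage coors (~` A).
Proof. exact: sigma_algebraC. Qed.

Let rV_bigcup (F : _^nat) : (forall i, g_sigma_preimage coors (F i)) ->
  g_sigma_preimage coors (\bigcup_i (F i)).
Proof. exact: sigma_algebra_bigcup. Qed.

HB.instance Definition _ := @isMeasurable.Build
  (measure_tuple_display default_measure_display)
  'rV[R]_n (g_sigma_preimage coors) rV_set0 rV_setC rV_bigcup.

End measurable_rV.

Section measurable_rV_lemmas.
Context (R : realType).

Lemma measurable_rV_coord n (i : 'I_n) :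
  measurable_fun [set: 'rV[R]_n] (fun x : 'rV[R]_n => x ord0 i).
Proof.
move=> _ B mB; rewrite setTI; apply: sub_sigma_algebra => /=.
rewrite -bigcup_seq/=; exists i => /=; first by rewrite mem_index_enum.
by exists B => //; rewrite setTI.
Qed.

Lemma measurable_fun_rV d (T : measurableType d) n (f : T -> 'rV[R]_n) :
  (forall i, measurable_fun [set: T] (fun t => f t ord0 i)) ->
  measurable_fun [set: T] f.
Proof.
move=> mf.
apply: (@measurability _ _ _ _ _ _ (\big[setU/set0]_(i < n)
  preimage_set_system setT (fun x : 'rV[R]_n => x ord0 i) measurable)) => //.
move=> _ [B + <-]; rewrite -bigcup_seq => -[i _ [A mA <-]].
by rewrite setTI setTI -[X in measurable X]setTI; exact: (mf i).
Qed.

End measurable_rV_lemmas.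

Section rV_cons.
Context (R : realType) (n : nat).

Definition rV_cons (z : measurableTypeR R * 'rV[R]_n) : 'rV[R]_n.+1 :=
  row_mx (z.1 : R)%:M z.2.

Definition rV_uncons (x : 'rV[R]_n.+1) : measurableTypeR R * 'rV[R]_n :=
  (x ord0 ord0, \row_(j < n) x ord0 (lift ord0 j)).

Lemma rV_cons0 z : rV_cons z ord0 ord0 = z.1.
Proof.
rewrite /rV_cons (_ : ord0 = lshift n (ord0 : 'I_1)); last exact/val_inj.
by rewrite (@row_mxEl R 1 1 n) mxE eqxx mulr1n.
Qed.

Lemma rV_consS z j : rV_cons z ord0 (lift ord0 j) = z.2 ord0 j.
Proof.
rewrite /rV_cons (_ : lift ord0 j = rshift 1 j); last exact/val_inj.
by rewrite (@row_mxEr R 1 1 n).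
Qed.

Lemma rV_consK : cancel rV_cons rV_uncons.
Proof.
move=> [a x]; rewrite /rV_uncons rV_cons0; congr pair.
by apply/rowP => j; rewrite mxE rV_consS.
Qed.

Lemma measurable_rV_cons : measurable_fun setT rV_cons.
Proof.
apply: measurable_fun_rV => i.
have [j ->|->] := unliftP ord0 i.
  rewrite (_ : (fun _ => _) = (fun x : 'rV[R]_n => x ord0 j) \o snd).
    apply: measurableT_comp; first exact: measurable_rV_coord.
    exact: measurable_snd.
  by apply/funext => z /=; rewrite rV_consS.
rewrite (_ : (fun _ => _) = fst); first exact: measurable_fst.
by apply/funext => z; rewrite -rV_cons0.
Qed.

Lemma measurable_rV_uncons : measurable_fun setT rV_uncons.
Proof.
apply: measurable_fun_pair; first exact: measurable_rV_coord.
apply: measurable_fun_rV => i; under eq_fun do rewrite mxE.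
exact: measurable_rV_coord.
Qed.

HB.instance Definition _ :=
  isMeasurableFun.Build _ _ _ _ rV_cons measurable_rV_cons.

End rV_cons.

Section lebesgue_rV_step.
Context (R : realType) (n : nat).
Variable mu : {sigma_finite_measure set 'rV[R]_n -> \bar R}.
Local Open Scope ereal_scope.

Definition lebesgue_rV_step : set 'rV[R]_n.+1 -> \bar R :=
  pushforward (lebesgue_measure \x mu) (@rV_cons R n).

Let step0 : lebesgue_rV_step set0 = 0.
Proof. by rewrite /lebesgue_rV_step /pushforward preimage_set0 measure0. Qed.

Let step_ge0 A : 0 <= lebesgue_rV_step A.
Proof. exact: measure_ge0. Qed.

Let step_sigma_additive : semi_sigma_additive lebesgue_rV_step.
Proof.
exact: (@measure_semi_sigma_additive _ _ _
  (pushforward (lebesgue_measure \x mu) (@rV_cons R n))).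
Qed.

HB.instance Definition _ := isMeasure.Build _ _ _ lebesgue_rV_step
  step0 step_ge0 step_sigma_additive.

Let step_sigma_finite : sigma_finite setT lebesgue_rV_step.
Proof.
have /sigma_finiteP[F [TF ndF Foo]] := sigma_finiteT (@lebesgue_measure R).
have /sigma_finiteP[G [TG ndG Goo]] := sigma_finiteT mu.
exists (fun k => @rV_uncons R n @^-1` (F k `*` G k)).
  apply/seteqP; split => // x _.
  have [i _ Fi] : (\bigcup_i F i) (rV_uncons x).1 by rewrite -TF.
  have [j _ Gj] : (\bigcup_j G j) (rV_uncons x).2 by rewrite -TG.
  exists (maxn i j) => //; split.
    by move: Fi; exact/subsetPset/ndF/leq_maxl.
  by move: Gj; exact/subsetPset/ndG/leq_maxr.
move=> k; have [mF Fk] := Foo k; have [mG Gk] := Goo k; split.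
  rewrite -[X in measurable X]setTI; apply: measurable_rV_uncons => //.
  exact: measurableX.
rewrite /lebesgue_rV_step /pushforward (_ : _ @^-1` _ = F k `*` G k).
  by rewrite product_measure1E// lte_mul_pinfty// ge0_fin_numE.
rewrite -comp_preimage (_ : _ \o _ = id) ?preimage_id//.
exact/funext/rV_consK.
Qed.

HB.instance Definition _ := Measure_isSigmaFinite.Build _ _ _ lebesgue_rV_step
  step_sigma_finite.

End lebesgue_rV_step.

Section lebesgue_rV.
Context (R : realType).
Local Open Scope ereal_scope.

(* The n-fold product of the Lebesgue measure of R, transported from
   R * (R * (... )) to row vectors; on R^0 it is the unit mass. *)
Fixpoint lebesgue_rV (n : nat) : {sigma_finite_measure set 'rV[R]_n -> \bar R} :=
  match n with
  | 0 => \d_(0%R : 'rV[R]_0)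
  | m.+1 => lebesgue_rV_step (lebesgue_rV m)
  end.

Lemma lebesgue_rV_box n (A : 'I_n -> set (measurableTypeR R)) :
  (forall i, measurable (A i)) ->
  lebesgue_rV n [set x | forall i, A i (x ord0 i)] =
  \prod_(i < n) lebesgue_measure (A i).
Proof.
elim: n A => [|n IHn] A mA.
  rewrite big_ord0 /= diracE mem_set//= => -[]//.
pose B := [set x : 'rV[R]_n | forall i, A (lift ord0 i) (x ord0 i)].
have mB : measurable B.
  rewrite (_ : B = \bigcap_(i in [set: 'I_n])
      ((fun x : 'rV[R]_n => x ord0 i) @^-1` A (lift ord0 i))); last first.
    by apply/seteqP; split => x /= xA i; [move=> _; exact: xA|exact: (xA i)].
  apply: fin_bigcap_measurable => // i _; rewrite -[X in measurable X]setTI.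
  by apply: measurable_rV_coord => //; exact: mA.
rewrite big_ord_recl -IHn; last by move=> i; exact: mA.
rewrite -product_measure1E//= /lebesgue_rV_step /pushforward; congr (_ _).
apply/seteqP; split => [z /= zA|z /= [z1A z2A] i].
  by split; [rewrite -rV_cons0|move=> i; rewrite -rV_consS].
by have [j ->|->] := unliftP ord0 i; rewrite ?rV_cons0 ?rV_consS.
Qed.

End lebesgue_rV.

Section domains.
Context (R : realType) (N : nat).
Implicit Types Omega : set 'rV[R]_N.

(* The library's norm on row vectors is the sup norm: same topology and
   same Lipschitz functions, but not the |x - y| of the fractional kernel. *)
Definition enorm (x : 'rV[R]_N) : R := Num.sqrt (\sum_(i < N) x ord0 i ^+ 2).

(* Near each boundary point, after a change of orthonormal coordinates
   y = x Q, Omega is the set lying strictly above a Lipschitz graph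
   y_i = gamma (y_j)_(j != i). *)
Definition lipschitz_boundary Omega :=
  forall x0, (closure Omega `\` Omega°) x0 ->
  exists (r : R) (Q : 'M[R]_N) (i : 'I_N) (gamma : 'rV[R]_N.-1 -> R^o),
    [/\ 0 < r, Q *m Q^T = 1%:M, lipschitz gamma &
      forall x, enorm (x - x0) < r ->
        (Omega x <-> gamma (col' i (x *m Q)) < (x *m Q) ord0 i)].

Definition is_domain Omega := [/\ Omega !=set0, open Omega & connected Omega].

Definition bounded_lipschitz_domain Omega :=
  [/\ is_domain Omega, bounded_set Omega & lipschitz_boundary Omega].

End domains.

Section weak_solutions.
Context (R : realType) (N : nat) (Omega : set 'rV[R]_N) (p s : R).
Local Open Scope ereal_scope.

Local Notation mu := (lebesgue_rV R N).
Local Notation COmega := (~` Omega).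

Definition in_Lp (D : set 'rV[R]_N) (q : R) (f : 'rV[R]_N -> R) :=
  measurable_fun D f /\ \int[mu]_(x in D) (`|f x| `^ q)%:E < +oo.

Definition Jp (t : R) : R := (`|t| `^ (p - 2) * t)%R.

Definition frac_kernel (z : 'rV[R]_N * 'rV[R]_N) : R :=
  ((enorm (z.1 - z.2) `^ (N%:R + p * s))^-1)%R.

Definition cross_domain : set ('rV[R]_N * 'rV[R]_N) := ~` (COmega `*` COmega).

Definition Xnorm_pow (g u : 'rV[R]_N -> R) : \bar R :=
  \int[mu]_(x in Omega) (`|u x| `^ p)%:E
  + \int[mu]_(x in COmega) (`| `|g x| `^ p^-1 * u x | `^ p)%:E
  + \int[mu \x mu]_(z in cross_domain) (`|u z.1 - u z.2| `^ p * frac_kernel z)%:E.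

(* Members of X are Borel representatives of the a.e. classes. *)
Definition inX (g u : 'rV[R]_N -> R) :=
  measurable_fun [set: 'rV[R]_N] u /\ Xnorm_pow g u < +oo.

(* For u, v in X, f in L^p'(Omega) and g in L^1(COmega), all three integrals
   converge absolutely by Hoelder's inequality. *)
Definition weak_solution (f g u : 'rV[R]_N -> R) :=
  inX g u /\
  forall v, inX g v ->
    (2^-1)%:E * \int[mu \x mu]_(z in cross_domain)
                  (Jp (u z.1 - u z.2) * (v z.1 - v z.2) * frac_kernel z)%:E
    = \int[mu]_(x in Omega) (f x * v x)%:E
      + \int[mu]_(x in ~` closure Omega) (g x * v x)%:E.

End weak_solutions.

(* Main.v *)
Require Import Defs.
From HB Require Import structures.
From mathcomp Require Import all_boot all_order all_algebra.
From mathcomp Require Import all_classical all_reals all_analysis.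
From mathcomp Require Import measurable_realfun.

Set Implicit Arguments.
Unset Strict Implicit.
Unset Printing Implicit Defensive.
Import Order.TTheory GRing.Theory Num.Theory.
Import numFieldNormedType.Exports.
Local Open Scope classical_set_scope.
Local Open Scope ring_scope.

(** The data are forced to vanish, and a solution with zero data has zero
    energy. Since Omega is bounded and g is integrable, the constant 1 belongs
    to the space X ([inX_cst1]); testing the equation against it annihilates
    the nonlocal term and leaves
      0 = int_Omega f + int_(exterior of Omega) g,
    a sum of two nonnegative numbers, so f = 0 and g = 0 almost everywhere
    ([data_eq0]). The right-hand side of the equation is then zero for every
    test function, in particular for u itself, whence
      int int |u x - u y| ^ p / |x - y| ^ (N + p s) dx dy = 0
    over the pairs (x, y) that are not both outside Omega. The kernel is
    positive off the diagonal, so u x = u y for almost all such pairs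
    ([energy_density_eq0]). By Fubini, for almost every x in Omega this holds
    for almost every y of the whole space, because (x, y) is an admissible pair
    as soon as x lies in Omega; and such an x exists because a nonempty open
    set has positive measure ([ae_constant_of_cross_domain]).

    The geometry of Omega enters only through the measure: open sets are
    measurable for the sigma-algebra generated by the coordinates, nonempty
    ones have positive measure, and bounded sets have finite measure. *)

(** * Open and bounded sets, and the kernel, in the Borel structure of R^n *)

Section borel_rV.
Context (R : realType).

Lemma measurable_rV_box n (A : 'I_n -> set (measurableTypeR R)) :
  (forall i, measurable (A i)) ->
  measurable [set x : 'rV[R]_n | forall i, A i (x ord0 i)].
Proof.
move=> mA.
rewrite (_ : [set _ | _] = \bigcap_(i in [set: 'I_n])
    ((fun x : 'rV[R]_n => x ord0 i) @^-1` A i)); last first.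
  by apply/seteqP; split => x /= xA i; [move=> _; exact: xA|exact: (xA i)].
apply: fin_bigcap_measurable => // i _; rewrite -[X in measurable X]setTI.
by apply: measurable_rV_coord => //; exact: mA.
Qed.

Lemma open_box_rV n (U : set 'rV[R]_n) x : open U -> U x ->
  exists2 e : R, 0 < e &
    [set y : 'rV[R]_n | forall i, `|x ord0 i - y ord0 i| < e] `<=` U.
Proof.
move=> oU Ux; have : nbhs x U by apply: open_nbhs_nbhs; split.
move/nbhs_ballP => [e /= e0 eU]; exists e => // y /= xy; apply: eU.
by split => // i j; rewrite (ord1 i); exact: xy.
Qed.

(** An open set is the union of the open boxes with rational corners that it
    contains, and there are countably many of these. *)
Lemma open_measurable_rV n (U : set 'rV[R]_n) : open U -> measurable U.
Proof.
move=> oU.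
(* A pair q holds the lower and the upper corner of a box. *)
pose box (q : 'rV[rat]_n * 'rV[rat]_n) : set 'rV[R]_n :=
  [set x | forall i, x ord0 i \in `]ratr (q.1 ord0 i), ratr (q.2 ord0 i)[].
rewrite (_ : U = \bigcup_q [set x | box q x /\ box q `<=` U]).
  apply: countable_bigcupT_measurable => [|q]; first exact: countableP.
  have [qU|qU] := pselect (box q `<=` U).
    rewrite (_ : [set _ | _] = box q); last first.
      by apply/seteqP; split => x /=; [case|].
    exact: (@measurable_rV_box n
      (fun i => [set` `]ratr (q.1 ord0 i), ratr (q.2 ord0 i)[])).
  by rewrite (_ : [set _ | _] = set0)//; apply/seteqP; split => x //= [].
apply/seteqP; split => [x Ux|x [q _ [xq +]]]; last exact.
have [e e0 eU] := open_box_rV oU Ux.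
have /choice[a ha] i : exists q : rat, ratr q \in `](x ord0 i - e), (x ord0 i)[.
  by apply: rat_in_itvoo; rewrite ltrBlDr ltrDl.
have /choice[b hb] i : exists q : rat, ratr q \in `](x ord0 i), (x ord0 i + e)[.
  by apply: rat_in_itvoo; rewrite ltrDl.
exists (\row_i a i, \row_i b i) => //; split => [i|y /= aby].
  rewrite !mxE in_itv/=.
  by move: (ha i) (hb i); rewrite !in_itv/= => /andP[_ ->] /andP[-> _].
apply: eU => i; move: (ha i) (hb i) (aby i); rewrite !mxE !in_itv/=.
move=> /andP[a1 _] /andP[_ b1] /andP[a2 b2].
rewrite distrC ltr_distl; apply/andP; split.
  exact: lt_trans a2.
exact: lt_trans b1.
Qed.

Lemma lebesgue_rV_open_gt0 n (U : set 'rV[R]_n) : open U -> U !=set0 ->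
  (0 < lebesgue_rV R n U)%E.
Proof.
move=> oU [x Ux]; have [e e0 eU] := open_box_rV oU Ux.
pose A i : set (measurableTypeR R) := ball (x ord0 i) e.
have mA i : measurable (A i) by exact: measurable_ball.
apply: (@lt_le_trans _ _ (lebesgue_rV R n [set y | forall i, A i (y ord0 i)])).
  rewrite lebesgue_rV_box//; elim/big_ind : _ => // [a b|i _].
    exact: mule_gt0.
  by rewrite lebesgue_measure_ball ?ltW// lte_fin mulrn_wgt0.
apply: le_measure => //; rewrite inE; first exact: measurable_rV_box.
exact: open_measurable_rV.
Qed.

Lemma lebesgue_rV_bounded_lty n (U : set 'rV[R]_n) : measurable U ->
  bounded_set U -> (lebesgue_rV R n U < +oo)%E.
Proof.
move=> mU /pinfty_ex_gt0[M M0 UM].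
pose A (i : 'I_n) : set (measurableTypeR R) := closed_ball (0 : R) M.
have mA i : measurable (A i) by exact: measurable_closed_ball.
apply: (@le_lt_trans _ _ (lebesgue_rV R n [set y | forall i, A i (y ord0 i)])).
  apply: le_measure; rewrite ?inE//; first exact: measurable_rV_box.
  move=> y Uy i; rewrite /A closed_ballE// /closed_ball_/= sub0r normrN.
  apply: le_trans (UM _ Uy); rewrite /Num.norm/= mx_normrE.
  exact: (le_bigmax _ _ (ord0, i)).
rewrite lebesgue_rV_box// -ge0_fin_numE; last by apply: prode_ge0.
rewrite prode_fin_num// => i _.
by rewrite lebesgue_measure_closed_ball ?ltW.
Qed.

Lemma enorm_eq0 n (x : 'rV[R]_n) : enorm x = 0 -> x = 0.
Proof.
move=> /eqP; rewrite sqrtr_eq0 => x0; apply/rowP => i; rewrite mxE.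
have /eqP : \sum_(i < n) x ord0 i ^+ 2 = 0.
  by apply/eqP; rewrite eq_le x0 sumr_ge0// => j _; exact: sqr_ge0.
rewrite psumr_eq0; last by move=> j _; exact: sqr_ge0.
by move=> /allP/(_ i); rewrite mem_index_enum sqrf_eq0 => /(_ isT)/eqP.
Qed.

Lemma measurable_enorm n : measurable_fun setT (@enorm R n).
Proof.
apply: (@measurableT_comp _ _ _ _ _ _ (@Num.sqrt R)).
  apply: continuous_measurable_fun; exact: sqrt_continuous.
apply: measurable_sum => i; apply: measurable_funX.
exact: measurable_rV_coord.
Qed.

Lemma measurable_frac_kernel n (p s : R) :
  measurable_fun setT (@frac_kernel R n p s).
Proof.
rewrite /frac_kernel; under eq_fun do rewrite -powRN.
apply: (measurableT_comp (measurable_powR _)).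
apply: (measurableT_comp (@measurable_enorm n)).
apply: measurable_fun_rV => i; under eq_fun do rewrite !mxE.
by apply: measurable_funB; apply: (measurableT_comp (measurable_rV_coord i)).
Qed.

End borel_rV.

(** * Consequences of integrals that vanish *)

(** Tonelli for null sets: the measure of a null set of the product is the
    integral of the measures of its sections. *)
Lemma ae_prod_ae_xsection d1 d2 (T1 : measurableType d1)
    (T2 : measurableType d2) (R : realType)
    (m1 : {sigma_finite_measure set T1 -> \bar R})
    (m2 : {sigma_finite_measure set T2 -> \bar R}) (P : T1 * T2 -> Prop) :
  {ae (m1 \x m2)%E, forall z, P z} ->
  {ae m1, forall x, {ae m2, forall y, P (x, y)}}.
Proof.
move=> [A [mA A0 PA]].
have : ae_eq m1 setT (m2 \o xsection A) (cst 0%E).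
  apply/ae_eq_integral_abs => //; first exact: measurable_fun_xsection.
  by rewrite -[RHS]A0; apply: eq_integral => x _; rewrite gee0_abs.
apply: filterS => x /= /(_ I) Ax0; exists (xsection A x); split => //.
  exact: measurable_xsection.
by move=> y /= Py; rewrite /xsection/= inE; exact: PA.
Qed.

Section ae_nonneg.
Context d (T : measurableType d) (R : realType).
Variables (mu : {measure set T -> \bar R}) (D : set T) (h : T -> R).
Hypotheses (mD : measurable D) (mh : measurable_fun D h).
Hypothesis h_ge0 : {ae mu, forall x, D x -> 0 <= h x}.

Let integral_abs :
  (\int[mu]_(x in D) (h x)%:E = \int[mu]_(x in D) `|(h x)%:E|)%E.
Proof.
apply: ae_eq_integral => //.
- exact/measurable_EFinP.
- by apply: measurableT_comp => //; exact/measurable_EFinP.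
- by apply: filterS h_ge0 => x hx Dx; rewrite gee0_abs// lee_fin hx.
Qed.

Lemma ae_integral_ge0 : (0 <= \int[mu]_(x in D) (h x)%:E)%E.
Proof. by rewrite integral_abs integral_ge0. Qed.

Lemma ae_integral_eq0 : (\int[mu]_(x in D) (h x)%:E = 0)%E ->
  {ae mu, forall x, D x -> h x = 0}.
Proof.
rewrite integral_abs => /ae_eq_integral_abs h0.
by apply: filterS (h0 mD _) => [x /= /[apply] -[]|]; last exact/measurable_EFinP.
Qed.

End ae_nonneg.

Lemma ae_integral_mul0 d (T : measurableType d) (R : realType)
    (mu : {measure set T -> \bar R}) (D : set T) (h k : T -> R) :
  measurable D -> measurable_fun D h -> measurable_fun D k ->
  {ae mu, forall x, D x -> h x = 0} ->
  (\int[mu]_(x in D) (h x * k x)%:E = 0)%E.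
Proof.
move=> mD mh mk h0; rewrite (ae_eq_integral (cst 0%E))//; first exact: integral0.
- by apply/measurable_EFinP; exact: measurable_funM.
- by apply: filterS h0 => x hx /hx ->; rewrite mul0r.
Qed.

(** * Weak solutions *)

Lemma exterior_subC (R : realType) N (Omega : set 'rV[R]_N) :
  ~` closure Omega `<=` ~` Omega.
Proof. by apply: subsetC; exact: subset_closure. Qed.

Lemma measurable_exterior (R : realType) N (Omega : set 'rV[R]_N) :
  measurable (~` closure Omega).
Proof.
by apply: open_measurable_rV; apply: closed_openC; exact: closed_closure.
Qed.

Section weak_solution_constant.
Context (R : realType) (N : nat) (Omega : set 'rV[R]_N) (p s : R).
Context (f g : 'rV[R]_N -> R).
Hypothesis oOmega : open Omega.
Local Notation mu := (lebesgue_rV R N).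

Let mOmega : measurable Omega := open_measurable_rV oOmega.

Lemma measurable_cross_domain : measurable (cross_domain Omega).
Proof. by apply: measurableC; apply: measurableX; exact: measurableC. Qed.

(** The exterior term of the norm of the constant 1 is the integral of |g|,
    because the weight |g| ^ (1 / p) is raised to the power p. *)
Lemma inX_cst1 : p != 0 -> bounded_set Omega ->
  mu.-integrable (~` Omega) (EFin \o g) -> inX Omega p s g (cst 1).
Proof.
move=> p0 bOmega /integrableP[_ gfin]; split; first exact: measurable_cst.
rewrite /Xnorm_pow; under eq_integral do rewrite normr1 powR1.
rewrite integral_cst// mul1e.
rewrite [X in (_ + X + _)%E](_ : _ =
    \int[mu]_(x in ~` Omega) `|(EFin \o g) x|)%E; last first.
  apply: eq_integral => x _ /=.
  by rewrite mulr1 ger0_norm ?powR_ge0// -powRrM mulVf// powRr1.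
rewrite [X in (_ + X)%E](_ : _ = 0%E); last first.
  apply: integral0_eq => z _ /=.
  by rewrite subrr normr0 powR0// mul0r.
by rewrite adde0 lte_add_pinfty// lebesgue_rV_bounded_lty.
Qed.

Lemma energy_density_ge0 (u : 'rV[R]_N -> R) z :
  0 <= Jp p (u z.1 - u z.2) * (u z.1 - u z.2) * frac_kernel p s z.
Proof.
apply: mulr_ge0; last by rewrite invr_ge0 powR_ge0.
by rewrite /Jp -mulrA -expr2; apply: mulr_ge0; rewrite ?sqr_ge0 ?powR_ge0.
Qed.

(** The first two factors vanish only when u z.1 = u z.2. The kernel vanishes
    only on the diagonal, where the inverse of 0 is 0, and there the two values
    of u coincide trivially. *)
Lemma energy_density_eq0 (u : 'rV[R]_N -> R) z :
  Jp p (u z.1 - u z.2) * (u z.1 - u z.2) * frac_kernel p s z = 0 ->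
  u z.1 = u z.2.
Proof.
move=> /eqP; rewrite !mulf_eq0 invr_eq0 !powR_eq0 normr_eq0 subr_eq0.
move=> /orP[/orP[/orP[/andP[/eqP//]|/eqP//]|/eqP//]|/andP[/eqP/enorm_eq0 z0 _]].
by rewrite -[z.1](subrK z.2) z0 add0r.
Qed.

Lemma measurable_energy_density (u : 'rV[R]_N -> R) : measurable_fun setT u ->
  measurable_fun setT (fun z : 'rV[R]_N * 'rV[R]_N =>
    Jp p (u z.1 - u z.2) * (u z.1 - u z.2) * frac_kernel p s z).
Proof.
move=> mu_u.
have mdu : measurable_fun setT (fun z : 'rV[R]_N * 'rV[R]_N => u z.1 - u z.2).
  by apply: measurable_funB; apply: (measurableT_comp mu_u).
apply: measurable_funM; last exact: measurable_frac_kernel.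
apply: measurable_funM => //; apply: measurable_funM => //.
apply: (measurableT_comp (measurable_powR _)).
exact: measurableT_comp.
Qed.

(** For x in Omega, the pair (x, y) lies in the cross domain whatever y is, so
    a single generic x in Omega determines the value of u almost everywhere. *)
Lemma ae_constant_of_cross_domain (u : 'rV[R]_N -> R) : Omega !=set0 ->
  {ae (mu \x mu)%E, forall z, cross_domain Omega z -> u z.1 = u z.2} ->
  exists c : R, {ae mu, forall x, u x = c}.
Proof.
move=> Omega0 /ae_prod_ae_xsection aeu.
have [x [Ox ux]] : exists x, Omega x /\
    {ae mu, forall y, cross_domain Omega (x, y) -> u x = u y}.
  apply: contrapT => nOmega.
  have : mu.-negligible Omega.
    apply: negligibleS aeu => x Ox /= aex; apply: nOmega; exists x.
    by split => //; apply: filterS aex.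
  move/(negligibleP _ mOmega) => Omega_null.
  by have := lebesgue_rV_open_gt0 oOmega Omega0; rewrite Omega_null ltxx.
exists (u x); apply: filterS ux => y ->//.
by move=> -[].
Qed.

(** Tested against the constant 1, the equation says that the integrals of f
    and g, both nonnegative, add up to zero. *)
Lemma data_eq0 (u : 'rV[R]_N -> R) :
  measurable_fun Omega f -> measurable_fun (~` Omega) g ->
  {ae mu, forall x, Omega x -> 0 <= f x} ->
  {ae mu, forall x, (~` Omega) x -> 0 <= g x} ->
  inX Omega p s g (cst 1) -> weak_solution Omega p s f g u ->
  {ae mu, forall x, Omega x -> f x = 0} /\
  {ae mu, forall x, (~` closure Omega) x -> g x = 0}.
Proof.
move=> mf mg f0 g0 X1 [_ /(_ _ X1)].
have mext := measurable_exterior Omega.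
have mg_ext : measurable_fun (~` closure Omega) g.
  exact: measurable_funS (measurableC mOmega) (@exterior_subC R N Omega) mg.
have {}g0 : {ae mu, forall x, (~` closure Omega) x -> 0 <= g x}.
  by apply: filterS g0 => x gx /exterior_subC.
rewrite integral0_eq => [|z _]; last by rewrite /= subrr mulr0 mul0r.
under eq_integral do rewrite mulr1.
under [X in (_ + X)%E]eq_integral do rewrite mulr1.
rewrite mule0 => /esym/eqP.
rewrite padde_eq0 ?ae_integral_ge0// => /andP[/eqP intf /eqP intg].
by split; apply: ae_integral_eq0.
Qed.

End weak_solution_constant.

Theorem proposition2p10 (R : realType) (N : nat) (Omega : set 'rV[R]_N)
    (p s : R) (f g u : 'rV[R]_N -> R)
    (hN : (1 <= N)%N)
    (hOmega : bounded_lipschitz_domain Omega)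
    (hp : 1 < p) (hs0 : 0 < s) (hs1 : s < 1)
    (hf : in_Lp Omega (p / (p - 1)) f)
    (hg : (lebesgue_rV R N).-integrable (~` Omega) (EFin \o g))
    (hu : weak_solution Omega p s f g u)
    (f_ge0 : {ae lebesgue_rV R N, forall x, Omega x -> 0 <= f x})
    (g_ge0 : {ae lebesgue_rV R N, forall x, (~` Omega) x -> 0 <= g x}) :
  exists c : R, {ae lebesgue_rV R N, forall x, u x = c}.
Proof.
have [[ne0 oOmega _] bOmega _] := hOmega.
have [mf _] := hf.
have mg : measurable_fun (~` Omega) g.
  by apply/measurable_EFinP; exact: measurable_int hg.
have X1 : inX Omega p s g (cst 1).
  by apply: inX_cst1 => //; rewrite gt_eqF// (lt_trans ltr01).
have [f0 g0] := data_eq0 oOmega mf mg f_ge0 g_ge0 X1 hu.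
(* The equation tested against u equates the energy of u with zero. *)
have [Xu /(_ _ Xu)] := hu.
have mu_u : measurable_fun setT u by case: Xu.
have mOmega := open_measurable_rV oOmega.
have mext := measurable_exterior Omega.
have mg_ext : measurable_fun (~` closure Omega) g.
  exact: measurable_funS (measurableC mOmega) (@exterior_subC R N Omega) mg.
rewrite (ae_integral_mul0 mOmega mf (measurable_funTS mu_u) f0).
rewrite (ae_integral_mul0 mext mg_ext (measurable_funTS mu_u) g0).
rewrite adde0 => /eqP; rewrite mule_eq0 eqe invr_eq0 pnatr_eq0/= => /eqP energy0.
apply: (ae_constant_of_cross_domain oOmega ne0).
have := ae_integral_eq0 (measurable_cross_domain oOmega)
  (measurable_funTS (measurable_energy_density p s mu_u)) _ energy0.
move=> /(_ (aeW _ (fun z _ => energy_density_ge0 p s u z))).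
by apply: filterS => z duz /duz; exact: energy_density_eq0.
Qed.
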